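(* Let $\mathbf{X}\in\mathbb{R}^{n\times p}$ be deterministic, $\beta^*\in\mathbb{R}^p$, let $\varepsilon$ be a random vector in $\mathbb{R}^n$ and $y=\mathbf{X}\beta^*+\varepsilon$. Let $h$ be a norm on $\mathbb{R}^p$ and let $\hat\beta\in\operatorname*{argmin}_{\beta\in\mathbb{R}^p}\|\mathbf{X}\beta-y\|^2+2h(\beta)$. Then almost surely $$\sup_{u\in\mathbb{R}^p:\ \|\mathbf{X}u\|\le 1}\big[\varepsilon^T\mathbf{X}u-h(u)\big]\ \le\ \|\mathbf{X}(\hat\beta-\beta^* )\|.$$
   Context: $\|\cdot\|$ is the Euclidean norm. *)

(* Defs.v *)
From mathcomp Require Import all_boot all_order all_algebra.
From mathcomp Require Import all_classical all_reals all_analysis.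

Set Implicit Arguments.
Unset Strict Implicit.
Unset Printing Implicit Defensive.

Import Order.TTheory GRing.Theory Num.Theory.
Import numFieldNormedType.Exports.

Local Open Scope classical_set_scope.
Local Open Scope ring_scope.

(* The norm `|v| that MathComp-Analysis puts on matrices is the sup norm. *)
Definition enorm (R : realType) (m : nat) (v : 'cV[R]_m) : R :=
  Num.sqrt (\sum_(i < m) v i ord0 ^+ 2).

Definition dotv (R : realType) (m : nat) (v w : 'cV[R]_m) : R :=
  (v^T *m w) ord0 ord0.

(* An arbitrary norm on R^p cannot be given by the canonical instance on
   'cV[R]_p, which is the sup norm, so it is a function with the norm axioms;
   nonnegativity and h 0 = 0 follow from them. *)
Definition is_norm (R : realType) (p : nat) (h : 'cV[R]_p -> R) : Prop :=
  [/\ forall u v, h (u + v) <= h u + h v,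
      forall (a : R) u, h (a *: u) = `|a| * h u
    & forall u, h u = 0 -> u = 0].

Definition argmin (R : realType) (U : Type) (f : U -> R) : set U :=
  [set b | forall b', f b <= f b'].

(* Column vectors carry no measurable structure in the library; measurability
   of all coordinates is Borel measurability of the vector. *)
Definition random_vector (d : measure_display) (T : measurableType d)
    (R : realType) (P : probability T R) (n : nat) (X : T -> 'cV[R]_n) : Prop :=
  forall i : 'I_n, measurable_fun [set: T] (fun w => X w i ord0).

Definition penalized_ls (R : realType) (n p : nat) (X : 'M[R]_(n, p))
    (y : 'cV[R]_n) (h : 'cV[R]_p -> R) (b : 'cV[R]_p) : R :=
  enorm (X *m b - y) ^+ 2 + 2 * h b.

(* Main.v *)
(** The minimality of [bhat] tested against [bhat + t u], [t > 0], together with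
    the sublinearity of [h] gives, after division by [2 t] and [t -> 0],
    [<y - X bhat, X u> <= h u] for every [u].
    Since [y - X bhat = eps - X (bhat - bstar)], this says
    [<eps, X u> - h u <= <X (bhat - bstar), X u>], and Cauchy-Schwarz concludes. *)
Require Import Defs.
From mathcomp Require Import all_boot all_order all_algebra.
From mathcomp Require Import all_classical all_reals all_analysis.
From mathcomp Require Import ring lra.

Import Order.TTheory GRing.Theory Num.Theory.
Import numFieldNormedType.Exports.

Local Open Scope classical_set_scope.
Local Open Scope ring_scope.

Section EuclideanSpace.
Variables (R : realType) (m : nat).
Implicit Types u v w : 'cV[R]_m.

Lemma dotvE v w : dotv v w = \sum_(i < m) v i ord0 * w i ord0.
Proof. by rewrite /dotv mxE; apply: eq_bigr => i _; rewrite mxE. Qed.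

Lemma dotvBl u v w : dotv (u - v) w = dotv u w - dotv v w.
Proof. by rewrite /dotv linearB mulmxBl !mxE. Qed.

Lemma dotvNl u v : dotv (- u) v = - dotv u v.
Proof. by rewrite /dotv linearN mulNmx mxE. Qed.

Lemma enorm_ge0 v : 0 <= enorm v.
Proof. exact: sqrtr_ge0. Qed.

Lemma sqr_enorm v : enorm v ^+ 2 = \sum_(i < m) v i ord0 ^+ 2.
Proof. by rewrite sqr_sqrtr// sumr_ge0// => i _; exact: sqr_ge0. Qed.

Lemma enorm0_eq0 v : enorm v = 0 -> v = 0.
Proof.
move=> v0; have /eqP := sqr_enorm v; rewrite v0 expr0n eq_sym.
rewrite psumr_eq0 => [/allP vi0|i _]; last exact: sqr_ge0.
apply/matrixP => i j; rewrite ord1 mxE; apply/eqP.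
by rewrite -sqrf_eq0; exact: vi0 (mem_index_enum i).
Qed.

(** Used twice: for Cauchy-Schwarz, and to expand the residual of a perturbed minimizer. *)
Lemma sqr_enorm_lin (a b : R) v w :
  enorm (a *: v + b *: w) ^+ 2 =
  a ^+ 2 * enorm v ^+ 2 + 2 * (a * b) * dotv v w + b ^+ 2 * enorm w ^+ 2.
Proof.
rewrite !sqr_enorm dotvE !mulr_sumr -!big_split/=.
by apply: eq_bigr => i _; rewrite !mxE; ring.
Qed.

(** Cauchy-Schwarz: the squared norm of [enorm w *: v - enorm v *: w] equals
    [2 * (enorm v * enorm w)] times the gap between the two sides. Zero vectors are treated apart so
    that this factor can be cancelled. *)
Lemma dotv_le_enorm v w : dotv v w <= enorm v * enorm w.
Proof.
have [v0|v_neq0] := eqVneq (enorm v) 0.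
  by rewrite v0 mul0r (enorm0_eq0 _ v0) /dotv trmx0 mul0mx mxE.
have [w0|w_neq0] := eqVneq (enorm w) 0.
  by rewrite w0 mulr0 (enorm0_eq0 _ w0) /dotv mulmx0 mxE.
have vw_gt0 : 0 < 2 * (enorm v * enorm w).
  by rewrite !mulr_gt0// lt0r enorm_ge0 ?v_neq0 ?w_neq0.
rewrite -(ler_pM2l vw_gt0) -subr_ge0.
have := sqr_ge0 (enorm (enorm w *: v + (- enorm v) *: w)).
by rewrite sqr_enorm_lin; congr (_ <= _); ring.
Qed.

End EuclideanSpace.

Lemma penalized_ls_argmin_dotv_le (R : realType) (n p : nat)
    (X : 'M[R]_(n, p)) (y : 'cV[R]_n) (h : 'cV[R]_p -> R) (b u : 'cV[R]_p) :
  is_norm h -> argmin (penalized_ls X y h) b ->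
  dotv (y - X *m b) (X *m u) <= h u.
Proof.
(* The limit [t -> 0] is replaced by an arbitrary slack [e] and a single step size [t] adapted to
   it. *)
move=> [h_tri h_hom _] b_min; apply/ler_addgt0Pr => e e_gt0.
pose q := enorm (X *m u) ^+ 2; have q_ge0 : 0 <= q by exact: sqr_ge0.
(* with this [t] the quadratic remainder [t * q / 2] is at most [e] *)
pose t := 2 * e / (q + 1).
have t_gt0 : 0 < t by rewrite divr_gt0 ?mulr_gt0// ltr_wpDl.
have tq : t * q <= 2 * e.
  by rewrite /t mulrAC ler_pdivrMr ?ltr_wpDl//; nra.
have hbtu : h (b + t *: u) <= h b + t * h u.
  by rewrite (le_trans (h_tri _ _))// h_hom gtr0_norm.
have := b_min (b + t *: u); rewrite /penalized_ls.
have -> : X *m (b + t *: u) - y = 1 *: (X *m b - y) + t *: (X *m u).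
  by rewrite mulmxDr -scalemxAr scale1r addrAC.
rewrite sqr_enorm_lin -/q -(opprB y) dotvNl; set D := dotv _ _ => F_le.
(* The squared residual at [b] and [2 * h b] cancel from both sides of [F_le], leaving only terms
   divisible by [t]. *)
have : t * (2 * D) <= t * (2 * h u + t * q) by nra.
by rewrite ler_pM2l//; lra.
Qed.

Theorem theorem3p4 (R : realType) (d : measure_display) (T : measurableType d)
    (P : probability T R) (n p : nat) (X : 'M[R]_(n, p)) (bstar : 'cV[R]_p)
    (eps : T -> 'cV[R]_n) (heps : random_vector P eps)
    (y : T -> 'cV[R]_n) (hy : forall w, y w = X *m bstar + eps w)
    (h : 'cV[R]_p -> R) (hh : is_norm h)
    (bhat : T -> 'cV[R]_p)
    (hbhat : {ae P, forall w, argmin (penalized_ls X (y w) h) (bhat w)}) :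
  {ae P, forall w,
    (ereal_sup [set (dotv (eps w) (X *m u) - h u)%R%:E |
                  u in [set u : 'cV[R]_p | (enorm (X *m u) <= 1)%R]]
     <= (enorm (X *m (bhat w - bstar)%R))%:E)%E}.
Proof.
(* The argument is pathwise: it works at every [w] where [bhat w] is a minimizer. *)
apply: filterS hbhat => w b_min.
apply: ge_ereal_sup => _ [u /= Xu_le1 <-]; rewrite lee_fin.
have := penalized_ls_argmin_dotv_le _ _ _ _ _ _ _ u hh b_min.
have -> : y w - X *m bhat w = eps w - X *m (bhat w - bstar).
  by rewrite hy mulmxBr opprB addrCA addrA.
rewrite dotvBl => opt.
apply: (@le_trans _ _ (dotv (X *m (bhat w - bstar)) (X *m u))); first by lra.
(* The constraint [enorm (X *m u) <= 1] absorbs the second Cauchy-Schwarz factor. *)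
by rewrite (le_trans (dotv_le_enorm _ _ _ _))// ler_piMr// enorm_ge0.
Qed.
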